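(* Let $n\ge1$, $m\ge1$ and let $\mathcal{B}$ be a Boolean algebra with $2^m$ elements. Then $B^{\mathcal{B}}_n$ has exactly $(n+2)^m$ elements.
   Context: For a Boolean algebra $\mathcal{B}$ and $n\ge1$, $B^{\mathcal{B}}_n=\{z\in|\mathcal{B}|^{n+1}: (\bigwedge_{i=1}^k z_{[i]})\vee z_{[k+1]}=1 \text{ for all } 1\le k\le n\}$, where $z_{[i]}$ is the $i$-th coordinate of $z$. *)

(* Defs.v *)
From mathcomp Require Import all_boot all_order.

Set Implicit Arguments.
Unset Strict Implicit.
Unset Printing Implicit Defensive.

Import Order.Theory.

(* Coordinates of a tuple are numbered from 0, so for 1 <= k <= n the
   (k+1)-st coordinate z_[k+1] is [tnth z k], and the meet of z_[1], ..., z_[k]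
   is the meet of the [tnth z i] with i < k. *)
Definition Bset (d : Order.disp_t) (B : ctbDistrLatticeType d) (n : nat) :
    {pred n.+1.-tuple B} :=
  [pred z : n.+1.-tuple B |
    [forall k : 'I_n.+1, (1 <= k <= n)%N ==>
      (((\meet_(i < n.+1 | (i < k)%N) tnth z i) `|` tnth z k)%O == \top%O)]].

Arguments Bset {d} B n _.

(* Main.v *)
Require Import Defs.
From mathcomp Require Import all_boot all_order.

(** A finite Boolean algebra is determined by its set of atoms, so [2 ^ m]
elements means [m] atoms. The defining equations of [Bset] say that any two
coordinates of [z] have join [\top]; read at a fixed atom [a], this means that
[a] is missing from at most one of the [n + 1] coordinates. A tuple is thus the
same as a free choice, for each atom, of one of [n + 2] possibilities: the
coordinate avoiding it, or none. *)

Set Implicit Arguments.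
Unset Strict Implicit.
Unset Printing Implicit Defensive.

Import Order.Theory.

Section Atoms.
Context {d : Order.disp_t} {B : finCTBDistrLatticeType d}.
Implicit Types (a x y : B).
Local Open Scope order_scope.

Definition atom a :=
  (a != \bot) && [forall b : B, (b <= a) ==> ((b == \bot) || (b == a))].

Lemma atomP a :
  reflect (a != \bot /\ forall b, b <= a -> b = \bot \/ b = a) (atom a).
Proof.
apply: (iffP andP) => -[an0 amin]; split=> //.
  by move=> b lba; case/orP: (implyP (forallP amin b) lba) => /eqP; [left|right].
apply/forallP => b; apply/implyP => /amin.
by case=> ->; rewrite eqxx ?orbT.
Qed.

(** Induction on the number of elements strictly below [x]: if [x] is not an atom, some nonzero
    [b < x] has strictly fewer elements below it. *)
Lemma exists_atom_le x : x != \bot -> exists2 a, atom a & a <= x.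
Proof.
move: {2}#|_| (leqnn #|[set y | y < x]|) => k.
elim: k x => [|k IHk] x lek xn0.
  move: lek; rewrite leqn0 cards_eq0 => /eqP /setP /(_ \bot).
  by rewrite !inE lt0x xn0.
have [xatom|] := boolP (atom x); first by exists x.
rewrite /atom xn0 /= negb_forall => /existsP[b].
rewrite negb_imply negb_or => /and3P[lebx bn0 bnx].
have ltbx : b < x by rewrite lt_neqAle bnx.
have [] := IHk b _ bn0; last first.
  by move=> a aatom leab; exists a => //; apply: le_trans leab lebx.
rewrite -ltnS; apply: leq_trans lek; apply: proper_card; apply/properP; split.
  by apply/subsetP => y; rewrite !inE => /lt_trans; apply.
by exists b; rewrite !inE ?ltxx.
Qed.

(** Atoms are join-prime: [a & x] is [\bot] or [a] by minimality, and in the first case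
    distributivity gives [a & y = a]. *)
Lemma atom_leU a x y : atom a -> (a <= x `|` y) = (a <= x) || (a <= y).
Proof.
move=> /atomP[_ amin]; apply/idP/orP => [leaxy|[]]; last 2 first.
- by move=> /le_trans; apply; apply: leUl.
- by move=> /le_trans; apply; apply: leUr.
have [ax0|<-] := amin (a `&` x) (leIl _ _); last by left; apply: leIr.
right; apply/meet_idPl; move: leaxy => /meet_idPl.
by rewrite meetUr ax0 join0x.
Qed.

Lemma atom_le_joins (I : finType) (P : pred I) (F : I -> B) a : atom a ->
  (a <= \join_(i | P i) F i) = [exists (i | P i), a <= F i].
Proof.
move=> aatom; rewrite -big_orE.
apply: (big_morph (fun x => a <= x)) => [x y|]; first exact: atom_leU.
by rewrite lex0; apply/negbTE; case/atomP: aatom.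
Qed.

Lemma atom_le_atom a b : atom a -> atom b -> (a <= b) = (a == b).
Proof.
move=> /atomP[an0 _] /atomP[_ bmin].
apply/idP/eqP => [/bmin[a0|//]|->//].
by rewrite a0 eqxx in an0.
Qed.

(** Otherwise the difference of [x] and [y] is nonzero, and an atom below it would lie below both
    [y] and its complement. *)
Lemma le_atoms x y : (forall a, atom a -> a <= x -> a <= y) -> x <= y.
Proof.
move=> sxy; rewrite -diff_eq0; apply: contraT => /exists_atom_le[a aatom].
rewrite diffE lexI => /andP[/(sxy a aatom) leay leaNy].
have : a <= y `&` ~` y by rewrite lexI leay.
by rewrite meetxC lex0; case/atomP: aatom => /negbTE ->.
Qed.

Lemma eq_atoms x y : (forall a, atom a -> (a <= x) = (a <= y)) -> x = y.
Proof.
by move=> exy; apply: le_anti; rewrite !le_atoms // => a /exy ->.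
Qed.

(** Join-primality, together with the incomparability of distinct atoms, makes a set of atoms
    recoverable from its join. *)
Lemma atom_le_join_atoms (P : pred {a : B | atom a}) (a : {a : B | atom a}) :
  (val a <= \join_(b | P b) val b) = P a.
Proof.
rewrite atom_le_joins ?(valP a) //; apply/existsP/idP => [[b /andP[Pb]]|Pa].
  by rewrite atom_le_atom ?(valP a) ?(valP b) // => /eqP/val_inj ->.
by exists a; rewrite Pa /=.
Qed.

(** Finite Stone duality: taking the atoms below an element and joining a set of atoms are mutually
    inverse. *)
Lemma card_atoms : #|B| = (2 ^ #|{: {a : B | atom a}}|)%N.
Proof.
have eqB : cancel (fun x => [set b : {a : B | atom a} | val b <= x])
                  (fun S : {set _} => \join_(b in S) val b).
  move=> x; apply: eq_atoms => a aatom.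
  by rewrite (atom_le_join_atoms _ (exist _ a aatom)) inE.
have eqS : cancel (fun S : {set _} => \join_(b in S) val b)
                  (fun x => [set b : {a : B | atom a} | val b <= x]).
  by move=> S; apply/setP => a; rewrite inE atom_le_join_atoms.
by rewrite (bij_eq_card (Bijective eqB eqS)) -cardsT -powersetT card_powerset
           cardsT.
Qed.

(** By join-primality, an atom below [\top] lies below coordinate [j] or below the meet of all
    earlier coordinates, hence below each of them. *)
Lemma BsetP n (z : n.+1.-tuple B) :
  reflect (forall (i j : 'I_n.+1) a, (i < j)%N -> atom a ->
             (a <= tnth z i) || (a <= tnth z j))
          (z \in Bset B n).
Proof.
apply: (iffP forallP) => [zB i j a ltij aatom|zB k].
  have /eqP zij := implyP (zB j) (introT andP (conj
    (leq_ltn_trans (leq0n i) ltij) (leq_ord j))).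
  have := lex1 a; rewrite -zij atom_leU // => /orP[leam|->]; last by rewrite orbT.
  by rewrite (le_trans leam) //; apply: meets_inf.
apply/implyP => _; rewrite -le1x; apply: le_atoms => a aatom _.
rewrite atom_leU //; have [_|nleak] := boolP (a <= tnth z k); first by rewrite orbT.
rewrite orbF; apply/meetsP => i ltik.
by have := zB i k a ltik aatom; rewrite (negbTE nleak) orbF.
Qed.

End Atoms.

Section AvoidingCoordinate.
Context {d : Order.disp_t} {B : finCTBDistrLatticeType d} {n : nat}.
Local Notation At := {a : B | atom a}.
Local Open Scope order_scope.

(** [f a = Some i] makes [i] the only coordinate that [a] is not below; [None] puts [a] below all of
    them. *)
Definition tuple_of_avoiding (f : {ffun At -> option 'I_n.+1}) :
    n.+1.-tuple B :=
  [tuple \join_(a | f a != Some i) val a | i < n.+1].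

Lemma atom_le_tuple_of_avoiding f (a : At) i :
  (val a <= tnth (tuple_of_avoiding f) i) = (f a != Some i).
Proof. by rewrite tnth_mktuple atom_le_join_atoms. Qed.

Lemma tuple_of_avoiding_inj : injective tuple_of_avoiding.
Proof.
move=> f g efg; apply/ffunP => a.
have {}efg i : (f a == Some i) = (g a == Some i).
  by apply: negb_inj; rewrite -!atom_le_tuple_of_avoiding efg.
case efa: (f a) => [i|].
  by apply/esym/eqP; rewrite -efg efa.
case ega: (g a) => [i|//].
by move: (efg i); rewrite efa ega eqxx.
Qed.

Lemma codom_tuple_of_avoiding : codom tuple_of_avoiding =i Bset B n.
Proof.
move=> z; apply/codomP/BsetP => [[f ->] i j a ltij aatom|zB].
  rewrite !(atom_le_tuple_of_avoiding f (exist _ a aatom)) -negb_and.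
  apply/negP => /andP[/eqP-> /eqP[eij]].
  by rewrite eij ltnn in ltij.
(* [pick] chooses a coordinate that [a] is not below, and returns [None] when there is no such
   coordinate. *)
exists [ffun a : At => [pick i | ~~ (val a <= tnth z i)]].
apply: eq_from_tnth => i; apply: eq_atoms => a aatom.
rewrite (atom_le_tuple_of_avoiding _ (exist _ a aatom)) ffunE /=.
case: pickP => [j nleaj|/(_ i)/negbFE -> //].
(* The choice is forced: [a] avoids coordinate [j], so [zB], applied in whichever order [i] and [j]
   come, puts [a] below every other coordinate. *)
have [[<-]|/eqP neij] := Some j =P Some i; first exact: negbTE.
have {neij} : val i != val j by apply: contraNneq neij => /val_inj ->.
rewrite neq_ltn => /orP[] ltij; have := zB _ _ a ltij aatom;
by rewrite (negbTE nleaj) ?orbF.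
Qed.

Lemma card_Bset : #|Bset B n| = (n.+2 ^ #|{: At}|)%N.
Proof.
rewrite -(eq_card codom_tuple_of_avoiding) (card_codom tuple_of_avoiding_inj).
by rewrite card_ffun card_option card_ord.
Qed.

End AvoidingCoordinate.

Unset Implicit Arguments.

Theorem theorem5p4 (n m : nat) (hn : 1 <= n) (hm : 1 <= m)
    (d : Order.disp_t) (B : finCTBDistrLatticeType d)
    (hB : #|B| = 2 ^ m) :
  #|Bset B n| = (n + 2) ^ m.
Proof.
(* Comparing exponents of 2 identifies [m] as the number of atoms. *)
move: hB; rewrite card_atoms => /eqP; rewrite eqn_exp2l // => /eqP <-.
by rewrite card_Bset addn2.
Qed.
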